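(* In the definition of an Ann-category, the compatibility of the functors $A\otimes -$ and $-\otimes A$ with the commutativity constraint $c$ follows from the other axioms, even without the symmetry axiom for $c$ and without the compatibility of $c$ with $a^+$. Precisely: let $(\mathcal A,\oplus,\otimes,a^+,c,(0,g,d),a,(1,l,r),\mathcal L,\mathcal R)$ be data satisfying the weakened list of axioms (i)-(vi) given in the context. Then for all objects $A,X,Y$ of $\mathcal A$, $$c_{A\otimes X,A\otimes Y}\circ\mathcal L_{A,X,Y}=\mathcal L_{A,Y,X}\circ(\mathrm{id}_A\otimes c_{X,Y}),\qquad c_{X\otimes A,Y\otimes A}\circ\mathcal R_{X,Y,A}=\mathcal R_{Y,X,A}\circ(c_{X,Y}\otimes\mathrm{id}_A).$$
   Context: We write $AB$ for $A\otimes B$. The weakened list of axioms (those of an Ann-category, with the symmetry condition $c_{Y,X}\circ c_{X,Y}=\mathrm{id}$, the hexagon relating $c$ and $a^+$, and the compatibility of $A\otimes-$ and $-\otimes A$ with $c$ removed) is: (i) $\mathcal A$ is a groupoid with two bifunctors $\oplus,\otimes:\mathcal A\times\mathcal A\to\mathcal A$. (ii) $(\mathcal A,\oplus,a^+,(0,g,d))$ is a monoidal category, with $a^+_{X,Y,Z}:X\oplus(Y\oplus Z)\to(X\oplus Y)\oplus Z$, $g_X:0\oplus X\to X$, $d_X:X\oplus0\to X$, in which every object is invertible up to isomorphism for $\oplus$; and $c_{X,Y}:X\oplus Y\to Y\oplus X$ is a natural isomorphism (no further condition on $c$). (iii) $(\mathcal A,\otimes,a,(1,l,r))$ is a monoidal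 category, with $a_{A,B,C}:A(BC)\to(AB)C$, $l_X:1X\to X$, $r_X:X1\to X$. (iv) $\mathcal L_{A,X,Y}:A(X\oplus Y)\to AX\oplus AY$ and $\mathcal R_{X,Y,A}:(X\oplus Y)A\to XA\oplus YA$ are natural isomorphisms (natural in all variables) compatible with $a^+$: $$a^+_{AX,AY,AZ}\circ(\mathrm{id}\oplus\mathcal L_{A,Y,Z})\circ\mathcal L_{A,X,Y\oplus Z}=(\mathcal L_{A,X,Y}\oplus\mathrm{id})\circ\mathcal L_{A,X\oplus Y,Z}\circ(\mathrm{id}_A\otimes a^+_{X,Y,Z}),$$ $$a^+_{XA,YA,ZA}\circ(\mathrm{id}\oplus\mathcal R_{Y,Z,A})\circ\mathcal R_{X,Y\oplus Z,A}=(\mathcal R_{X,Y,A}\oplus\mathrm{id})\circ\mathcal R_{X\oplus Y,Z,A}\circ(a^+_{X,Y,Z}\otimes\mathrm{id}_A).$$ (v) For all objects: (1.1) $\mathcal L_{AB,X,Y}\circ a_{A,B,X\oplus Y}=(a_{A,B,X}\oplus a_{A,B,Y})\circ\mathcal L_{A,BX,BY}\circ(\mathrm{id}_A\otimes\mathcal L_{B,X,Y})$; (1.1') $\mathcal R_{XB,YB,A}\circ(\mathcal R_{X,Y,B}\otimes\mathrm{id}_A)\circ a_{X\oplus Y,B,A}=(a_{X,B,A}\oplus a_{Y,B,A})\circ\mathcal R_{X,Y,BA}$; (1.2) $\mathcal R_{AX,AY,B}\circ(\mathcal L_{A,X,Y}\otimes\mathrm{id}_B)\circ a_{A,X\oplus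 Y,B}=(a_{A,X,B}\oplus a_{A,Y,B})\circ\mathcal L_{A,XB,YB}\circ(\mathrm{id}_A\otimes\mathcal R_{X,Y,B})$; (1.3) $v_{AX,BX,AY,BY}\circ(\mathcal R_{A,B,X}\oplus\mathcal R_{A,B,Y})\circ\mathcal L_{A\oplus B,X,Y}=(\mathcal L_{A,X,Y}\oplus\mathcal L_{B,X,Y})\circ\mathcal R_{A,B,X\oplus Y}$, where $v_{U,V,Z,T}:(U\oplus V)\oplus(Z\oplus T)\to(U\oplus Z)\oplus(V\oplus T)$ is the composite $$(U\oplus V)\oplus(Z\oplus T)\to((U\oplus V)\oplus Z)\oplus T\to(U\oplus(V\oplus Z))\oplus T\to(U\oplus(Z\oplus V))\oplus T\to((U\oplus Z)\oplus V)\oplus T\to(U\oplus Z)\oplus(V\oplus T)$$ of $a^+_{U\oplus V,Z,T}$, $(a^+_{U,V,Z})^{-1}\oplus\mathrm{id}_T$, $(\mathrm{id}_U\oplus c_{V,Z})\oplus\mathrm{id}_T$, $a^+_{U,Z,V}\oplus\mathrm{id}_T$, $(a^+_{U\oplus Z,V,T})^{-1}$. (vi) $(l_X\oplus l_Y)\circ\mathcal L_{1,X,Y}=l_{X\oplus Y}$ and $(r_X\oplus r_Y)\circ\mathcal R_{X,Y,1}=r_{X\oplus Y}$. *)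

(* Defs.v *)
From Corelib Require Import ssreflect.

Set Implicit Arguments.
Unset Strict Implicit.
Unset Printing Implicit Defensive.

Declare Scope ann_scope.
Local Open Scope ann_scope.

Record category := Category {
  ob :> Type;
  hom : ob -> ob -> Type;
  idm : forall X, hom X X;
  comp : forall X Y Z, hom Y Z -> hom X Y -> hom X Z;
  compA : forall X Y Z T (h : hom Z T) (g : hom Y Z) (f : hom X Y),
    comp h (comp g f) = comp (comp h g) f;
  comp1m : forall X Y (f : hom X Y), comp (idm Y) f = f;
  compm1 : forall X Y (f : hom X Y), comp f (idm X) = f }.

Arguments idm {c} X.

Notation "X ~> Y" := (hom X Y) (at level 90, no associativity) : ann_scope.
Notation "g ∘ f" := (comp g f) (at level 40, left associativity) : ann_scope.

Record groupoid := Groupoid {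
  gcat :> category;
  inv : forall X Y : gcat, (X ~> Y) -> (Y ~> X);
  compVm : forall (X Y : gcat) (f : X ~> Y), inv f ∘ f = idm X;
  compmV : forall (X Y : gcat) (f : X ~> Y), f ∘ inv f = idm Y }.

Record bifunctor (C : category) := Bifunctor {
  bob :> C -> C -> C;
  bmap : forall X X' Y Y' : C, (X ~> X') -> (Y ~> Y') -> (bob X Y ~> bob X' Y');
  bmap_id : forall X Y : C, bmap (idm X) (idm Y) = idm (bob X Y);
  bmap_comp : forall (X X' X'' Y Y' Y'' : C)
      (f' : X' ~> X'') (f : X ~> X') (g' : Y' ~> Y'') (g : Y ~> Y'),
    bmap (f' ∘ f) (g' ∘ g) = bmap f' g' ∘ bmap f g }.

(* Over a groupoid every morphism is invertible, so natural isomorphisms are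
   just natural families of morphisms. *)
Record monoidal_data (G : groupoid) (T : bifunctor G) := MonoidalData {
  munit : G;
  massoc : forall X Y Z : G, T X (T Y Z) ~> T (T X Y) Z;
  mleft : forall X : G, T munit X ~> X;
  mright : forall X : G, T X munit ~> X }.

Record is_monoidal (G : groupoid) (T : bifunctor G) (M : monoidal_data T) :
    Prop := IsMonoidal {
  massoc_nat : forall (X X' Y Y' Z Z' : G)
      (f : X ~> X') (g : Y ~> Y') (h : Z ~> Z'),
    massoc M X' Y' Z' ∘ bmap T f (bmap T g h)
      = bmap T (bmap T f g) h ∘ massoc M X Y Z;
  mleft_nat : forall (X X' : G) (f : X ~> X'),
    mleft M X' ∘ bmap T (idm (munit M)) f = f ∘ mleft M X;
  mright_nat : forall (X X' : G) (f : X ~> X'),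
    mright M X' ∘ bmap T f (idm (munit M)) = f ∘ mright M X;
  pentagon : forall X Y Z W : G,
    massoc M (T X Y) Z W ∘ massoc M X Y (T Z W)
      = bmap T (massoc M X Y Z) (idm W)
          ∘ massoc M X (T Y Z) W
          ∘ bmap T (idm X) (massoc M Y Z W);
  triangle : forall X Y : G,
    bmap T (mright M X) (idm Y) ∘ massoc M X (munit M) Y
      = bmap T (idm X) (mleft M Y) }.

Record ann_data := AnnData {
  ann_groupoid :> groupoid;
  oplus : bifunctor ann_groupoid;
  otimes : bifunctor ann_groupoid;
  addM : monoidal_data oplus;
  mulM : monoidal_data otimes;
  comm : forall X Y : ann_groupoid, oplus X Y ~> oplus Y X;
  distL : forall A X Y : ann_groupoid,
    otimes A (oplus X Y) ~> oplus (otimes A X) (otimes A Y);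
  distR : forall X Y A : ann_groupoid,
    otimes (oplus X Y) A ~> oplus (otimes X A) (otimes Y A) }.

(* The plain symbols act on objects, the subscripted ones on morphisms. *)
Notation "X ⊕ Y" := (oplus _ X Y)
  (at level 50, left associativity) : ann_scope.
Notation "X ⊗ Y" := (otimes _ X Y)
  (at level 39, left associativity) : ann_scope.
Notation "f ⊕ₘ g" := (bmap (oplus _) f g)
  (at level 38, left associativity) : ann_scope.
Notation "f ⊗ₘ g" := (bmap (otimes _) f g)
  (at level 38, left associativity) : ann_scope.

Definition zero_ob (A : ann_data) : A := munit (addM A).
Definition one_ob (A : ann_data) : A := munit (mulM A).
Definition addA (A : ann_data) (X Y Z : A) : X ⊕ (Y ⊕ Z) ~> (X ⊕ Y) ⊕ Z :=
  massoc (addM A) X Y Z.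
Definition mulA (A : ann_data) (X Y Z : A) : X ⊗ (Y ⊗ Z) ~> (X ⊗ Y) ⊗ Z :=
  massoc (mulM A) X Y Z.
Definition mul1l (A : ann_data) (X : A) : one_ob A ⊗ X ~> X := mleft (mulM A) X.
Definition mul1r (A : ann_data) (X : A) : X ⊗ one_ob A ~> X := mright (mulM A) X.

Definition interchange (A : ann_data) (U V Z T : A) :
    (U ⊕ V) ⊕ (Z ⊕ T) ~> (U ⊕ Z) ⊕ (V ⊕ T) :=
  inv (addA (U ⊕ Z) V T)
    ∘ (addA U Z V ⊕ₘ idm T)
    ∘ ((idm U ⊕ₘ comm V Z) ⊕ₘ idm T)
    ∘ (inv (addA U V Z) ⊕ₘ idm T)
    ∘ addA (U ⊕ V) Z T.

(* An Ann-category without the symmetry of [comm], its hexagon with [addA], or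
   the compatibility of [comm] with [distL] and [distR]. *)
Record weak_ann_category (A : ann_data) : Prop := WeakAnnCategory {
  add_monoidal : is_monoidal (addM A);
  (* In a groupoid a morphism witnesses that two objects are isomorphic. *)
  add_invertible : forall X : A, exists Y : A,
    inhabited (X ⊕ Y ~> zero_ob A) /\ inhabited (Y ⊕ X ~> zero_ob A);
  comm_nat : forall (X X' Y Y' : A) (f : X ~> X') (g : Y ~> Y'),
    comm X' Y' ∘ (f ⊕ₘ g) = (g ⊕ₘ f) ∘ comm X Y;

  mul_monoidal : is_monoidal (mulM A);

  distL_nat : forall (B B' X X' Y Y' : A)
      (h : B ~> B') (f : X ~> X') (g : Y ~> Y'),
    distL B' X' Y' ∘ (h ⊗ₘ (f ⊕ₘ g))
      = ((h ⊗ₘ f) ⊕ₘ (h ⊗ₘ g)) ∘ distL B X Y;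
  distR_nat : forall (X X' Y Y' B B' : A)
      (f : X ~> X') (g : Y ~> Y') (h : B ~> B'),
    distR X' Y' B' ∘ ((f ⊕ₘ g) ⊗ₘ h)
      = ((f ⊗ₘ h) ⊕ₘ (g ⊗ₘ h)) ∘ distR X Y B;
  distL_addA : forall B X Y Z : A,
    addA (B ⊗ X) (B ⊗ Y) (B ⊗ Z)
        ∘ (idm (B ⊗ X) ⊕ₘ distL B Y Z) ∘ distL B X (Y ⊕ Z)
      = (distL B X Y ⊕ₘ idm (B ⊗ Z))
          ∘ distL B (X ⊕ Y) Z ∘ (idm B ⊗ₘ addA X Y Z);
  distR_addA : forall X Y Z B : A,
    addA (X ⊗ B) (Y ⊗ B) (Z ⊗ B)
        ∘ (idm (X ⊗ B) ⊕ₘ distR Y Z B) ∘ distR X (Y ⊕ Z) B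
      = (distR X Y B ⊕ₘ idm (Z ⊗ B))
          ∘ distR (X ⊕ Y) Z B ∘ (addA X Y Z ⊗ₘ idm B);

  distL_mulA : forall B C X Y : A,
    distL (B ⊗ C) X Y ∘ mulA B C (X ⊕ Y)
      = (mulA B C X ⊕ₘ mulA B C Y)
          ∘ distL B (C ⊗ X) (C ⊗ Y) ∘ (idm B ⊗ₘ distL C X Y);
  distR_mulA : forall X Y B C : A,
    distR (X ⊗ B) (Y ⊗ B) C ∘ (distR X Y B ⊗ₘ idm C) ∘ mulA (X ⊕ Y) B C
      = (mulA X B C ⊕ₘ mulA Y B C) ∘ distR X Y (B ⊗ C);
  distLR_mulA : forall B X Y C : A,
    distR (B ⊗ X) (B ⊗ Y) C ∘ (distL B X Y ⊗ₘ idm C) ∘ mulA B (X ⊕ Y) C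
      = (mulA B X C ⊕ₘ mulA B Y C)
          ∘ distL B (X ⊗ C) (Y ⊗ C) ∘ (idm B ⊗ₘ distR X Y C);
  distLR_interchange : forall B C X Y : A,
    interchange (B ⊗ X) (C ⊗ X) (B ⊗ Y) (C ⊗ Y)
        ∘ (distR B C X ⊕ₘ distR B C Y) ∘ distL (B ⊕ C) X Y
      = (distL B X Y ⊕ₘ distL C X Y) ∘ distR B C (X ⊕ Y);

  distL_mul1l : forall X Y : A,
    (mul1l X ⊕ₘ mul1l Y) ∘ distL (one_ob A) X Y = mul1l (X ⊕ Y);
  distR_mul1r : forall X Y : A,
    (mul1r X ⊕ₘ mul1r Y) ∘ distR X Y (one_ob A) = mul1r (X ⊕ Y) }.

(* Main.v *)
From Corelib Require Import ssreflect.
Require Import Defs.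

(** The proof is the categorical form of the remark that commutativity of
    addition in a ring follows from the two ways of expanding
    [(1 + 1) * (x + y)].

    Expanding [(B ⊕ C) ⊗ (X ⊕ Y)] first on the left and then on the right, or
    the other way round, gives two sums of the same four products that differ
    by an interchange of the two middle terms; the axiom relating [distL] and
    [distR] says that this interchange [v] is the one built from [comm].  Hence
    [v] at four products is determined by [distL] and [distR] alone
    ([interchange_expand]).  Since the distributivity constraints commute with
    the associativity of the product, applying [A ⊗ -] to the two expansions
    for [B, C] yields the two expansions for [A ⊗ B, A ⊗ C]
    ([mulL_expandLR], [mulL_expandRL]), so [A ⊗ -] respects [v]
    ([mulL_preserves_interchange]); for [- ⊗ A] the expansions for [X, Y]
    become those for [X ⊗ A, Y ⊗ A], with the same conclusion.

    To descend from [v] to [comm], observe that [v] at [U, V, Z, T] is [comm V Z]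
    placed between [U] and [T], conjugated by reassociations.  A functor
    compatible with [addA]
    respects the reassociations, so respecting [v] amounts to respecting
    [comm V Z] between [U] and [T]; as objects are invertible for the sum, the
    outer summands can be cancelled ([preserves_interchange_comm]).
    With [B = C = 1] for [A ⊗ -], and [X = Y = 1] for [- ⊗ A], the four products
    are isomorphic to the given objects, and naturality of [comm] concludes. *)

Set Implicit Arguments.
Unset Strict Implicit.
Unset Printing Implicit Defensive.

Local Open Scope ann_scope.

(** * Cancellation in groupoids and for the sum *)

Section Groupoid.
Variable G : groupoid.

Lemma comp_cancelr (X Y Z : G) (f : X ~> Y) (g h : Y ~> Z) :
  g ∘ f = h ∘ f -> g = h.
Proof. by move=> e; rewrite -(compm1 g) -(compm1 h) -(compmV f) !compA e. Qed.

Lemma comp_cancell (X Y Z : G) (f : Y ~> Z) (g h : X ~> Y) :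
  f ∘ g = f ∘ h -> g = h.
Proof. by move=> e; rewrite -(comp1m g) -(comp1m h) -(compVm f) -!compA e. Qed.

Lemma inv_square (X X' Y Y' : G) (t : X ~> Y) (t' : X' ~> Y')
    (f : X ~> X') (g : Y ~> Y') :
  t' ∘ f = g ∘ t -> inv t' ∘ g = f ∘ inv t.
Proof.
move=> e; apply: (@comp_cancell _ _ _ t'); apply: (@comp_cancelr _ _ _ t).
by rewrite compA compmV comp1m compA e -!compA compVm compm1.
Qed.

Lemma comp_square (X1 X2 X3 Y1 Y2 Y3 : G)
    (t : X1 ~> X2) (u : X2 ~> X3) (t' : Y1 ~> Y2) (u' : Y2 ~> Y3)
    (f1 : X1 ~> Y1) (f2 : X2 ~> Y2) (f3 : X3 ~> Y3) :
  u' ∘ f2 = f3 ∘ u -> t' ∘ f1 = f2 ∘ t -> (u' ∘ t') ∘ f1 = f3 ∘ (u ∘ t).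
Proof. by move=> eu et; rewrite -compA et compA eu -compA. Qed.

Variable T : bifunctor G.

Lemma bmap_square (X1 X2 Y1 Y2 X1' X2' Y1' Y2' : G)
    (t : X1 ~> X2) (t' : Y1 ~> Y2) (f1 : X1 ~> Y1) (f2 : X2 ~> Y2)
    (s : X1' ~> X2') (s' : Y1' ~> Y2') (g1 : X1' ~> Y1') (g2 : X2' ~> Y2') :
  t' ∘ f1 = f2 ∘ t -> s' ∘ g1 = g2 ∘ s ->
  bmap T t' s' ∘ bmap T f1 g1 = bmap T f2 g2 ∘ bmap T t s.
Proof. by move=> e1 e2; rewrite -!bmap_comp e1 e2. Qed.

Lemma bmap_slide (X X' Y Y' : G) (f : X ~> X') (g : Y ~> Y') :
  bmap T (idm X') g ∘ bmap T f (idm Y) = bmap T f (idm Y') ∘ bmap T (idm X) g.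
Proof. by rewrite -!bmap_comp !comp1m !compm1. Qed.

End Groupoid.

Lemma id_square (G : groupoid) (X Y : G) (f : X ~> Y) :
  idm Y ∘ f = f ∘ idm X.
Proof. by rewrite comp1m compm1. Qed.

Section Faithful.
Variables (D : ann_data) (hD : weak_ann_category D).

(** If [S] is an inverse of [T], then adding [S] to [id_T ⊕ f] and
    reassociating gives [id_0 ⊕ f], which is [f] up to the unit constraint. *)
Lemma oplus_faithfull (T X Y : D) (f g : X ~> Y) :
  idm T ⊕ₘ f = idm T ⊕ₘ g -> f = g.
Proof.
move=> e; have [S [_ [h]]] := add_invertible hD T.
have hM := add_monoidal hD.
have e0 : idm (zero_ob D) ⊕ₘ f = idm (zero_ob D) ⊕ₘ g.
  have eST : idm (S ⊕ T) ⊕ₘ f = idm (S ⊕ T) ⊕ₘ g.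
    apply: (@comp_cancelr _ _ _ _ (addA S T X)).
    by rewrite -bmap_id -!(massoc_nat hM) e.
  apply: (@comp_cancelr _ _ _ _ (h ⊕ₘ idm X)).
  by rewrite !bmap_slide eST.
apply: (@comp_cancelr _ _ _ _ (mleft (addM D) X)).
by rewrite -!(mleft_nat hM) e0.
Qed.

Lemma oplus_faithfulr (T X Y : D) (f g : X ~> Y) :
  f ⊕ₘ idm T = g ⊕ₘ idm T -> f = g.
Proof.
move=> e; have [S [[h] _]] := add_invertible hD T.
have hM := add_monoidal hD.
have e0 : f ⊕ₘ idm (zero_ob D) = g ⊕ₘ idm (zero_ob D).
  have eTS : f ⊕ₘ idm (T ⊕ S) = g ⊕ₘ idm (T ⊕ S).
    apply: (@comp_cancell _ _ _ _ (addA Y T S)).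
    by rewrite -bmap_id !(massoc_nat hM) e.
  apply: (@comp_cancelr _ _ _ _ (idm X ⊕ₘ h)).
  by rewrite -!bmap_slide eTS.
apply: (@comp_cancelr _ _ _ _ (mright (addM D) X)).
by rewrite -!(mright_nat hM) e0.
Qed.

End Faithful.

(** * Additive functors *)

(** Both [A ⊗ -] and [- ⊗ A] are functors of this kind, with [fsum] given by
    [distL] and [distR], so that the passage from [interchange] to [comm] is
    made once for the two. *)
Record additive_functor (D : ann_data) := AdditiveFunctor {
  fob :> D -> D;
  fmap : forall X Y : D, (X ~> Y) -> (fob X ~> fob Y);
  fmap_id : forall X : D, fmap (idm X) = idm (fob X);
  fmap_comp : forall (X Y Z : D) (g : Y ~> Z) (f : X ~> Y),
    fmap (g ∘ f) = fmap g ∘ fmap f;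
  fsum : forall X Y : D, fob (X ⊕ Y) ~> fob X ⊕ fob Y;
  fsum_nat : forall (X X' Y Y' : D) (f : X ~> X') (g : Y ~> Y'),
    fsum X' Y' ∘ fmap (f ⊕ₘ g) = (fmap f ⊕ₘ fmap g) ∘ fsum X Y;
  fsum_addA : forall X Y Z : D,
    addA (fob X) (fob Y) (fob Z) ∘ ((idm (fob X) ⊕ₘ fsum Y Z) ∘ fsum X (Y ⊕ Z))
      = ((fsum X Y ⊕ₘ idm (fob Z)) ∘ fsum (X ⊕ Y) Z) ∘ fmap (addA X Y Z) }.

Section AdditiveFunctor.
Variables (D : ann_data) (hD : weak_ann_category D) (F : additive_functor D).

Definition preserves_comm (X Y : D) : Prop :=
  comm (F X) (F Y) ∘ fsum F X Y = fsum F Y X ∘ fmap F (comm X Y).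

Definition fsum4 (U V Z T : D) :
    F ((U ⊕ V) ⊕ (Z ⊕ T)) ~> (F U ⊕ F V) ⊕ (F Z ⊕ F T) :=
  (fsum F U V ⊕ₘ fsum F Z T) ∘ fsum F (U ⊕ V) (Z ⊕ T).

Definition preserves_interchange (U V Z T : D) : Prop :=
  interchange (F U) (F V) (F Z) (F T) ∘ fsum4 U V Z T
    = fsum4 U Z V T ∘ fmap F (interchange U V Z T).

(** In a groupoid [f] and [g] are isomorphisms, so that preservation transports
    along them by naturality of both [comm] and [fsum]. *)
Lemma preserves_comm_iso (X X' Y Y' : D) (f : X ~> X') (g : Y ~> Y') :
  preserves_comm X Y -> preserves_comm X' Y'.
Proof.
rewrite /preserves_comm => e.
apply: (@comp_cancelr _ _ _ _ (fmap F (f ⊕ₘ g))).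
rewrite -!compA fsum_nat -fmap_comp (comm_nat hD) fmap_comp compA (comm_nat hD).
by rewrite -compA e !compA fsum_nat.
Qed.

(** The reassociation that isolates the two terms exchanged by [interchange]:
    the latter is [comm] conjugated by [middle]. *)
Definition middle (U V Z T : D) :
    (U ⊕ V) ⊕ (Z ⊕ T) ~> (U ⊕ (V ⊕ Z)) ⊕ T :=
  (inv (addA U V Z) ⊕ₘ idm T) ∘ addA (U ⊕ V) Z T.

Lemma middle_interchange (U V Z T : D) :
  middle U Z V T ∘ interchange U V Z T
    = ((idm U ⊕ₘ comm V Z) ⊕ₘ idm T) ∘ middle U V Z T.
Proof.
rewrite /middle /interchange !compA -(compA _ _ (inv _)) compmV compm1.
by rewrite -bmap_comp compVm comp1m bmap_id comp1m.
Qed.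

Lemma fmap_inv (X Y : D) (f : X ~> Y) : fmap F (inv f) = inv (fmap F f).
Proof.
apply: (@comp_cancelr _ _ _ _ (fmap F f)).
by rewrite -fmap_comp !compVm fmap_id.
Qed.

(** The analogue of [fsum4] for the bracketing reached by [middle]. *)
Definition fsum_middle (U V Z T : D) :
    F ((U ⊕ (V ⊕ Z)) ⊕ T) ~> (F U ⊕ (F V ⊕ F Z)) ⊕ F T :=
  (((idm (F U) ⊕ₘ fsum F V Z) ∘ fsum F U (V ⊕ Z)) ⊕ₘ idm (F T))
    ∘ fsum F (U ⊕ (V ⊕ Z)) T.

Lemma fsum_natl (X X' T : D) (f : X ~> X') :
  fsum F X' T ∘ fmap F (f ⊕ₘ idm T) = (fmap F f ⊕ₘ idm (F T)) ∘ fsum F X T.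
Proof. by rewrite fsum_nat fmap_id. Qed.

Lemma fsum_natr (X X' T : D) (f : X ~> X') :
  fsum F T X' ∘ fmap F (idm T ⊕ₘ f) = (idm (F T) ⊕ₘ fmap F f) ∘ fsum F T X.
Proof. by rewrite fsum_nat fmap_id. Qed.

(** This is two uses of the compatibility with [addA]: once for [U ⊕ V, Z, T],
    once, inverted, for [U, V, Z]. *)
Lemma middle_fsum4 (U V Z T : D) :
  middle (F U) (F V) (F Z) (F T) ∘ fsum4 U V Z T
    = fsum_middle U V Z T ∘ fmap F (middle U V Z T).
Proof.
(* The inner [fsum F U V] must wait until [addA] has moved past it. *)
have split_fsum4 : fsum4 U V Z T =
    (fsum F U V ⊕ₘ (idm (F Z) ⊕ₘ idm (F T)))
      ∘ ((idm (F (U ⊕ V)) ⊕ₘ fsum F Z T) ∘ fsum F (U ⊕ V) (Z ⊕ T)).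
  by rewrite compA -bmap_comp bmap_id comp1m compm1.
have unassoc : inv (addA (F U) (F V) (F Z))
      ∘ ((fsum F U V ⊕ₘ idm (F Z)) ∘ fsum F (U ⊕ V) Z)
    = ((idm (F U) ⊕ₘ fsum F V Z) ∘ fsum F U (V ⊕ Z))
      ∘ fmap F (inv (addA U V Z)).
  by rewrite fmap_inv; apply: inv_square; apply: fsum_addA.
rewrite split_fsum4 /middle -compA (compA (addA _ _ _)).
rewrite (massoc_nat (add_monoidal hD)) -(compA _ (massoc _ _ _ _)) fsum_addA.
rewrite !compA -!bmap_comp !comp1m -(compA (inv _)) unassoc.
rewrite /fsum_middle fmap_comp compA -(compA _ (fsum F _ T) (fmap F (_ ⊕ₘ _))).
rewrite fsum_natl compA.
by rewrite -bmap_comp comp1m.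
Qed.

(** Conjugating by [middle] turns the hypothesis into the desired identity
    with [U] and [T] added on the two sides; these summands are cancelled by
    faithfulness of the sum. *)
Lemma preserves_interchange_comm (U V Z T : D) :
  preserves_interchange U V Z T -> preserves_comm V Z.
Proof.
move=> hv.
have e : ((idm (F U) ⊕ₘ comm (F V) (F Z)) ⊕ₘ idm (F T)) ∘ fsum_middle U V Z T
    = fsum_middle U Z V T ∘ fmap F ((idm U ⊕ₘ comm V Z) ⊕ₘ idm T).
  apply: (@comp_cancelr _ _ _ _ (fmap F (middle U V Z T))).
  rewrite -[LHS]compA -[RHS]compA -middle_fsum4 -fmap_comp -middle_interchange.
  by rewrite fmap_comp [LHS]compA [RHS]compA -middle_fsum4 -middle_interchange
             -[LHS]compA -[RHS]compA hv.
move: e; rewrite /fsum_middle -[RHS]compA fsum_natl !compA => /comp_cancelr.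
rewrite -!bmap_comp !comp1m => /(oplus_faithfulr hD).
rewrite -[RHS]compA fsum_natr !compA => /comp_cancelr.
by rewrite -!bmap_comp !comp1m => /(oplus_faithfull hD).
Qed.

End AdditiveFunctor.

(** * The two expansions of a product of sums *)

Section Distributivity.
Variables (D : ann_data) (hD : weak_ann_category D).

(** [interchange] is a composite of natural families, so its naturality square
    is pasted from theirs. *)
Lemma interchange_nat (U U' V V' Z Z' T T' : D)
    (f : U ~> U') (g : V ~> V') (h : Z ~> Z') (k : T ~> T') :
  interchange U' V' Z' T' ∘ ((f ⊕ₘ g) ⊕ₘ (h ⊕ₘ k))
    = ((f ⊕ₘ h) ⊕ₘ (g ⊕ₘ k)) ∘ interchange U V Z T.
Proof.
have assoc_nat := massoc_nat (add_monoidal hD).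
rewrite /interchange.
apply: comp_square (assoc_nat _ _ _ _ _ _ _ _ _).
apply: comp_square; last first.
  apply: bmap_square (id_square k).
  apply: inv_square; exact: assoc_nat.
apply: comp_square; last first.
  apply: bmap_square (id_square k).
  apply: bmap_square (id_square f) _; exact: comm_nat.
apply: comp_square; last first.
  apply: bmap_square (id_square k); exact: assoc_nat.
apply: inv_square; exact: assoc_nat.
Qed.

Lemma mulL_comp (A X Y Z : D) (g : Y ~> Z) (f : X ~> Y) :
  idm A ⊗ₘ (g ∘ f) = (idm A ⊗ₘ g) ∘ (idm A ⊗ₘ f).
Proof. by rewrite -bmap_comp comp1m. Qed.

Lemma mulR_comp (A X Y Z : D) (g : Y ~> Z) (f : X ~> Y) :
  (g ∘ f) ⊗ₘ idm A = (g ⊗ₘ idm A) ∘ (f ⊗ₘ idm A).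
Proof. by rewrite -bmap_comp comp1m. Qed.

Definition mulL (A : D) : additive_functor D.
Proof.
refine (@AdditiveFunctor D (fun X => A ⊗ X) (fun X Y f => idm A ⊗ₘ f)
  (fun X => bmap_id _ _ _) (@mulL_comp A) (distL A)
  (fun X X' Y Y' f g => distL_nat hD (idm A) f g) _).
by move=> X Y Z; rewrite compA; exact: distL_addA.
Defined.

Definition mulR (A : D) : additive_functor D.
Proof.
refine (@AdditiveFunctor D (fun X => X ⊗ A) (fun X Y f => f ⊗ₘ idm A)
  (fun X => bmap_id _ _ _) (@mulR_comp A) (fun X Y => distR X Y A)
  (fun X X' Y Y' f g => distR_nat hD f g (idm A)) _).
by move=> X Y Z; rewrite compA; exact: distR_addA.
Defined.

(** [expandLR] and [expandRL] are the two ways of multiplying out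
    [(B ⊕ C) ⊗ (X ⊕ Y)]. *)
Definition expandLR (B C X Y : D) :
    (B ⊕ C) ⊗ (X ⊕ Y) ~> (B ⊗ X ⊕ C ⊗ X) ⊕ (B ⊗ Y ⊕ C ⊗ Y) :=
  (distR B C X ⊕ₘ distR B C Y) ∘ distL (B ⊕ C) X Y.

Definition expandRL (B C X Y : D) :
    (B ⊕ C) ⊗ (X ⊕ Y) ~> (B ⊗ X ⊕ B ⊗ Y) ⊕ (C ⊗ X ⊕ C ⊗ Y) :=
  (distL B X Y ⊕ₘ distL C X Y) ∘ distR B C (X ⊕ Y).

Lemma interchange_expand (B C X Y : D) :
  interchange (B ⊗ X) (C ⊗ X) (B ⊗ Y) (C ⊗ Y) ∘ expandLR B C X Y
    = expandRL B C X Y.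
Proof. by rewrite compA; exact: distLR_interchange. Qed.

(** The [distR] steps are moved through [A ⊗ -] by [distLR_mulA], and the
    [distL] step by [distL_mulA]; what remains on the right distributes [A]
    over [B ⊕ C]. *)
Lemma mulL_expandLR (A B C X Y : D) :
  ((mulA A B X ⊕ₘ mulA A C X) ⊕ₘ (mulA A B Y ⊕ₘ mulA A C Y))
    ∘ (fsum4 (mulL A) (B ⊗ X) (C ⊗ X) (B ⊗ Y) (C ⊗ Y)
       ∘ fmap (mulL A) (expandLR B C X Y))
  = expandLR (A ⊗ B) (A ⊗ C) X Y
    ∘ ((distL A B C ⊗ₘ idm (X ⊕ Y)) ∘ mulA A (B ⊕ C) (X ⊕ Y)).
Proof.
rewrite /fsum4 /expandLR /= mulL_comp.
rewrite -(compA _ (distL A _ _)) (compA (distL A _ _)) (distL_nat hD).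
rewrite !compA -!bmap_comp -!(distLR_mulA hD).
rewrite !bmap_comp -!compA (compA (mulA _ _ _ ⊕ₘ _)) -(distL_mulA hD).
by rewrite (compA (_ ⊕ₘ _) (distL _ _ _)) -(distL_nat hD) bmap_id -!compA.
Qed.

(** The same two axioms as in [mulL_expandLR], in the opposite order.  The
    comparison [A ⊗ ((B ⊕ C) ⊗ (X ⊕ Y)) ~> (A ⊗ B ⊕ A ⊗ C) ⊗ (X ⊕ Y)] on the
    right is the same morphism for both expansions, so that it cancels out
    when they are compared. *)
Lemma mulL_expandRL (A B C X Y : D) :
  ((mulA A B X ⊕ₘ mulA A B Y) ⊕ₘ (mulA A C X ⊕ₘ mulA A C Y))
    ∘ (fsum4 (mulL A) (B ⊗ X) (B ⊗ Y) (C ⊗ X) (C ⊗ Y)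
       ∘ fmap (mulL A) (expandRL B C X Y))
  = expandRL (A ⊗ B) (A ⊗ C) X Y
    ∘ ((distL A B C ⊗ₘ idm (X ⊕ Y)) ∘ mulA A (B ⊕ C) (X ⊕ Y)).
Proof.
rewrite /fsum4 /expandRL /= mulL_comp.
rewrite -(compA _ (distL A _ _)) (compA (distL A _ _)) (distL_nat hD).
rewrite !compA -!bmap_comp -!(distL_mulA hD).
by rewrite !bmap_comp -!compA (compA (mulA _ _ _ ⊕ₘ _)) -(distLR_mulA hD) -!compA.
Qed.

(** Mirror image of [mulL_expandLR]: here [A] is distributed over [X ⊕ Y], by
    [distLR_mulA] for the [distL] step and [distR_mulA] for the [distR] ones. *)
Lemma mulR_expandLR (A B C X Y : D) :
  fsum4 (mulR A) (B ⊗ X) (C ⊗ X) (B ⊗ Y) (C ⊗ Y)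
    ∘ fmap (mulR A) (expandLR B C X Y) ∘ mulA (B ⊕ C) (X ⊕ Y) A
  = ((mulA B X A ⊕ₘ mulA C X A) ⊕ₘ (mulA B Y A ⊕ₘ mulA C Y A))
    ∘ (expandLR B C (X ⊗ A) (Y ⊗ A) ∘ (idm (B ⊕ C) ⊗ₘ distR X Y A)).
Proof.
rewrite /fsum4 /expandLR /= mulR_comp.
rewrite !compA -(compA _ (distR _ _ A)) (distR_nat hD) !compA -!bmap_comp.
rewrite -!compA (compA (distR _ _ A)) (distLR_mulA hD) !compA -!bmap_comp.
by rewrite !(distR_mulA hD).
Qed.

Lemma mulR_expandRL (A B C X Y : D) :
  fsum4 (mulR A) (B ⊗ X) (B ⊗ Y) (C ⊗ X) (C ⊗ Y)
    ∘ fmap (mulR A) (expandRL B C X Y) ∘ mulA (B ⊕ C) (X ⊕ Y) A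
  = ((mulA B X A ⊕ₘ mulA B Y A) ⊕ₘ (mulA C X A ⊕ₘ mulA C Y A))
    ∘ (expandRL B C (X ⊗ A) (Y ⊗ A) ∘ (idm (B ⊕ C) ⊗ₘ distR X Y A)).
Proof.
rewrite /fsum4 /expandRL /= mulR_comp.
rewrite !compA -(compA _ (distR _ _ A)) (distR_nat hD) !compA -!bmap_comp.
rewrite -!compA (compA (distR _ _ A)) (distR_mulA hD) !compA -!bmap_comp.
rewrite !(distLR_mulA hD) !bmap_comp -!compA.
by rewrite -(distR_nat hD) bmap_id.
Qed.

(** Precomposed with the first expansion and followed by [mulA], both sides
    become the second expansion for [A ⊗ B, A ⊗ C]; the added morphisms are
    invertible and cancel. *)
Lemma mulL_preserves_interchange (A B C X Y : D) :
  preserves_interchange (mulL A) (B ⊗ X) (C ⊗ X) (B ⊗ Y) (C ⊗ Y).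
Proof.
rewrite /preserves_interchange.
apply: (@comp_cancelr _ _ _ _ (fmap (mulL A) (expandLR B C X Y))).
rewrite -[LHS]compA -[RHS]compA -fmap_comp interchange_expand.
apply: (@comp_cancell _ _ _ _
  ((mulA A B X ⊕ₘ mulA A B Y) ⊕ₘ (mulA A C X ⊕ₘ mulA A C Y))).
rewrite mulL_expandRL [LHS]compA -interchange_nat -[LHS]compA mulL_expandLR.
by rewrite [LHS]compA interchange_expand.
Qed.

Lemma mulR_preserves_interchange (A B C X Y : D) :
  preserves_interchange (mulR A) (B ⊗ X) (C ⊗ X) (B ⊗ Y) (C ⊗ Y).
Proof.
rewrite /preserves_interchange.
apply: (@comp_cancelr _ _ _ _ (fmap (mulR A) (expandLR B C X Y))).
rewrite -[LHS]compA -[RHS]compA -fmap_comp interchange_expand.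
apply: (@comp_cancelr _ _ _ _ (mulA (B ⊕ C) (X ⊕ Y) A)).
rewrite -[LHS]compA mulR_expandLR mulR_expandRL [LHS]compA interchange_nat.
by rewrite -[LHS]compA (compA (interchange _ _ _ _)) interchange_expand.
Qed.

End Distributivity.

(** * Compatibility of the product with [comm] *)

Theorem proposition2 (D : ann_data) (hD : weak_ann_category D) (A X Y : D) :
  comm (A ⊗ X) (A ⊗ Y) ∘ distL A X Y = distL A Y X ∘ (idm A ⊗ₘ comm X Y) /\
  comm (X ⊗ A) (Y ⊗ A) ∘ distR X Y A = distR Y X A ∘ (comm X Y ⊗ₘ idm A).
Proof.
split.
(* Read along [mul1l], [X] and [Y] are the middle terms [1 ⊗ X] and [1 ⊗ Y] of
   the expansion of [(1 ⊕ 1) ⊗ (X ⊕ Y)]. *)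
- apply: (@preserves_comm_iso D hD (mulL hD A) _ _ _ _ (mul1l X) (mul1l Y)).
  exact: preserves_interchange_comm (mulL_preserves_interchange _ _ _ _ _ _).
(* Here the expanded product is [(Y ⊕ X) ⊗ (1 ⊕ 1)], whose middle terms are
   [X ⊗ 1] and [Y ⊗ 1]. *)
- apply: (@preserves_comm_iso D hD (mulR hD A) _ _ _ _ (mul1r X) (mul1r Y)).
  exact: preserves_interchange_comm (mulR_preserves_interchange _ _ _ _ _ _).
Qed.
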